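(* Let $\mu$ be a finite Borel measure on $[0,1)$ whose Radon-Nikodym derivative $g$ is bounded below. Suppose that $\{g_n\}_{n=-\infty}^{\infty}\subseteq L^2(\mu)$ is a semi-lower frame for $L^2(\mu)$ that is dextrodual to $\{e^{2\pi i n x}\}_{n=-\infty}^{\infty}$ in $L^2(\mu)$. Then $g$ is (essentially) bounded, and $\mu$ is absolutely continuous.
   Context: Measures are positive; ''absolutely continuous'' and ''singular'' are with respect to Lebesgue measure. The Radon-Nikodym derivative $g$ of $\mu$ means the density of the absolutely continuous part of $\mu$ with respect to Lebesgue measure (a singular part of $\mu$ is not excluded by hypothesis). $g$ bounded below means there is a constant $m>0$ with $g\ge m$ almost everywhere on $[0,1)$. A sequence $\{g_n\}$ in a Hilbert space $H$ is a semi-lower frame if there is $A>0$ with $A\|f\|^2\le\sum_n|\langle f,g_n\rangle|^2$ for all $f\in H$ (the sum may be infinite). A sequence $\{g_n\}$ is dextrodual to a sequence $\{x_n\}$ in $H$ if for all $x\in H$, $x=\sum_n\langle x,g_n\rangle x_n$, with (possibly conditional) convergence in norm; for sequences indexed by $\mathbb Z$ the sum is the limit of the symmetric partial sums $\sum_{n=-M}^{M}$ as $M\to\infty$. *)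

(* Defs.v *)
From HB Require Import structures.
From mathcomp Require Import all_boot all_order all_algebra.
From mathcomp Require Import all_classical all_reals all_analysis.
From mathcomp Require Import measurable_realfun complex.

Set Implicit Arguments.
Unset Strict Implicit.
Unset Printing Implicit Defensive.

Import Order.TTheory GRing.Theory Num.Theory.
Import numFieldNormedType.Exports.

Local Open Scope classical_set_scope.
Local Open Scope ring_scope.
Local Open Scope complex_scope.

(* The modulus as an element of R, since `|z| lives in R[i]. *)
Definition cmod (R : rcfType) (z : R[i]) : R := ComplexField.Normc.normc z.

(* Elements of the complex space L^2(mu) are handled through representatives;
   the notions below do not distinguish measurable functions that agree
   mu-a.e. *)
Section complexL2.
Context d (T : measurableType d) (R : realType).
Variable mu : {measure set T -> \bar R}.

Definition L2norm (f : T -> R[i]) : \bar R :=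
  Lnorm mu 2%:E (fun x => (cmod (f x))%:E).

Definition inL2 (f : T -> R[i]) : Prop :=
  [/\ measurable_fun [set: T] (fun x => complex.Re (f x)),
      measurable_fun [set: T] (fun x => complex.Im (f x)) &
      (L2norm f < +oo)%E].

Definition cintegral (f : T -> R[i]) : R[i] :=
  (\int[mu]_x complex.Re (f x)) +i* (\int[mu]_x complex.Im (f x)).

Definition L2inner (f g : T -> R[i]) : R[i] :=
  cintegral (fun x => f x * conjc (g x)).

Definition semi_lower_frame (g : int -> T -> R[i]) : Prop :=
  exists2 A : R, 0 < A &
    forall f : T -> R[i], inL2 f ->
      (A%:E * L2norm f ^+ 2 <=
       \esum_(n in [set: int]) (cmod (L2inner f (g n)) ^+ 2)%:E)%E.

(* sum of F n over the integers -M <= n <= M *)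
Definition symm_sum (F : int -> R[i]) (M : nat) : R[i] :=
  \sum_(0 <= k < M.*2.+1) F (k%:Z - M%:Z).

Definition dextrodual (g x : int -> T -> R[i]) : Prop :=
  forall f : T -> R[i], inL2 f ->
    (fun M : nat =>
       L2norm (fun t => f t - symm_sum (fun n => L2inner f (g n) * x n t) M))
      @ \oo --> 0%E.

End complexL2.

(* t |-> exp(2 pi i n t) *)
Definition cexponential (R : realType) (n : int) (t : R) : R[i] :=
  cos (2 * pi * n%:~R * t) +i* sin (2 * pi * n%:~R * t).

Section lebesgue_decomposition.
Context d (T : measurableType d) (R : realType).

Definition mutually_singular (m1 m2 : {measure set T -> \bar R}) : Prop :=
  exists N : set T, [/\ measurable N, m1 N = 0%E & m2 (~` N) = 0%E].

(* g is a version of the density of the absolutely continuous part of nu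
   in its Lebesgue decomposition with respect to mu.  (The library's
   'd nu '/d mu is only meaningful when nu `<< mu.) *)
Definition is_ac_density (nu mu : {measure set T -> \bar R})
    (g : T -> \bar R) : Prop :=
  [/\ measurable_fun [set: T] g,
      forall x, (0 <= g x)%E &
      exists2 s : {measure set T -> \bar R}, mutually_singular s mu &
        forall A : set T, measurable A ->
          nu A = (\int[mu]_(x in A) g x + s A)%E].

End lebesgue_decomposition.

(* Main.v *)
Require Import Defs.
From HB Require Import structures.
From mathcomp Require Import all_boot all_order all_algebra.
From mathcomp Require Import all_classical all_reals all_analysis.
From mathcomp Require Import measurable_realfun complex.
From mathcomp Require Import ring lra zify.

Import Order.TTheory GRing.Theory Num.Theory.
Import numFieldNormedType.Exports.

Local Open Scope classical_set_scope.
Local Open Scope ring_scope.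

(* Apply the expansion to the indicator of a measurable E in [0,1), with
   coefficients c_n.  As mu >= m dx on [0,1), the symmetric partial sums S_M
   also converge to 1_E in L^2(dx), where the exponentials are orthonormal, so
   that sum_{|n| <= M} |c_n|^2 = int |S_M|^2 dx.  From
   |S_M|^2 <= 2 |1_E|^2 + 2 |1_E - S_M|^2 this gives sum |c_n|^2 <= 2 |E|, and
   the lower frame inequality becomes A mu(E) <= 2 |E|: mu has no singular part
   and its density is at most 2 / A.  (The crude constant 2, instead of 1,
   spares the triangle inequality in L^2.) *)

Local Open Scope complex_scope.
Local Notation Re := complex.Re.
Local Notation Im := complex.Im.

(** * Orthonormality of the exponentials and Parseval's identity *)

Lemma cos_sin_2piz (R : realType) (n : int) :
  cos (2 * pi * n%:~R) = 1 :> R /\ sin (2 * pi * n%:~R) = 0 :> R.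
Proof.
have h (k : nat) : cos (2 * pi * k%:R) = 1 :> R /\ sin (2 * pi * k%:R) = 0 :> R.
  have -> : 2 * pi * k%:R = 0 + pi *+ 2 *+ k :> R.
    by rewrite add0r mulr_natl mulr_natr.
  by rewrite (periodicn (@cosD2pi R)) (periodicn (@sinD2pi R)) cos0 sin0.
case: n => k; first exact: h.
by rewrite NegzE mulrNz mulrN cosN sinN; have [-> ->] := h k.+1; rewrite oppr0.
Qed.

(** The integrand is the real part of [(a + i b) exp(2 pi i n x)]. For nonzero [n] it has the
    antiderivative [F] below, which takes equal values at 0 and 1 by periodicity. *)
Lemma integral_trigonometric (R : realType) (a b : R) (n : int) :
  (\int[@lebesgue_measure R]_(x in `[0%R, 1%R])
    (a * cos (2 * pi * n%:~R * x) - b * sin (2 * pi * n%:~R * x))%:E =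
  (if n == 0 then a else 0)%:E)%E.
Proof.
have [->|n0] := eqVneq n 0.
  under eq_integral do rewrite mulr0 mul0r cos0 sin0 mulr1 mulr0 subr0.
  rewrite integral_cst//= lebesgue_measure_itv/= lte01 oppr0 adde0.
  by rewrite mule1.
set w := 2 * pi * n%:~R.
have w0 : w != 0.
  by rewrite mulf_neq0 ?intr_eq0// mulf_neq0// gt_eqF// pi_gt0.
pose F (x : R) := w^-1 * (a * sin (w * x) + b * cos (w * x)).
have dF (x : R) : is_derive x 1 F (a * cos (w * x) - b * sin (w * x)).
  rewrite /F; apply: is_derive_eq.
  by rewrite /GRing.scale/= mulr1; field.
have cF : continuous F.
  move=> x; apply: differentiable_continuous; apply/derivable1_diffP.
  by have [] := dF x.
have cf : continuous (fun x : R => a * cos (w * x) - b * sin (w * x)).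
  move=> x; apply: differentiable_continuous; apply/derivable1_diffP.
  exact: ex_derive.
rewrite (@continuous_FTC2 _ _ F) //.
- rewrite /F !mulr0 sin0 cos0.
  have [cw sw] := cos_sin_2piz R n.
  by rewrite !mulr1 cw sw mulr0 !mulr1 add0r subee.
- exact: continuous_subspaceT.
- split.
  + by move=> x _; have [] := dF x.
  + exact/cvg_at_right_filter/cF.
  + exact/cvg_at_left_filter/cF.
- by move=> x _; rewrite derive1E; have [_ ->] := dF x.
Qed.

Lemma sqr_cmod (R : rcfType) (z : R[i]) : cmod z ^+ 2 = Re z ^+ 2 + Im z ^+ 2.
Proof. by case: z => a b; rewrite /cmod/= sqr_sqrtr// addr_ge0 ?sqr_ge0. Qed.

Lemma sqr_cmodE (R : rcfType) (z : R[i]) : cmod z ^+ 2 = Re (z * conjc z).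
Proof. by rewrite sqr_cmod; case: z => a b /=; rewrite mulrN opprK !expr2. Qed.

Lemma cexponentialM_conj (R : realType) (n m : int) (t : R) :
  cexponential n t * conjc (cexponential m t) = cexponential (n - m) t.
Proof.
rewrite /cexponential /= rmorphB/= mulrBr mulrBl.
rewrite cosB sinB; apply/eqP; rewrite eq_complex/=.
by apply/andP; split; apply/eqP; ring.
Qed.

Lemma Re_mulc_cexponential (R : realType) (z : R[i]) n (t : R) :
  Re (z * cexponential n t) =
  Re z * cos (2 * pi * n%:~R * t) - Im z * sin (2 * pi * n%:~R * t).
Proof. by case: z. Qed.

Lemma continuous_Re_mulc_cexponential (R : realType) (z : R[i]) n :
  continuous (fun t : R => Re (z * cexponential n t)).
Proof.
have -> : (fun t : R => Re (z * cexponential n t)) =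
   (fun t => Re z * cos (2 * pi * n%:~R * t) - Im z * sin (2 * pi * n%:~R * t)).
  by apply/funext => t; rewrite Re_mulc_cexponential.
move=> x; apply: differentiable_continuous; apply/derivable1_diffP.
exact: ex_derive.
Qed.

Lemma integral_Re_mulc_cexponential (R : realType) (z : R[i]) n :
  (\int[@lebesgue_measure R]_(t in `[0%R, 1%R]) (Re (z * cexponential n t))%:E =
   (if n == 0 then Re z else 0)%:E)%E.
Proof.
rewrite -(integral_trigonometric _ _ (Im z)).
by apply: eq_integral => t _; rewrite Re_mulc_cexponential.
Qed.

(** The squared modulus expands into a double sum of real parts of multiples of
    [exp(2 pi i (n - m) t)], whose off-diagonal terms integrate to zero. Taking real parts keeps all
    integrals real. *)
Lemma parseval_cexponential (R : realType) (s : seq int) (c : int -> R[i]) :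
  uniq s ->
  (\int[@lebesgue_measure R]_(t in `[0%R, 1%R])
     (cmod (\sum_(n <- s) c n * cexponential n t) ^+ 2)%:E =
   (\sum_(n <- s) cmod (c n) ^+ 2)%:E)%E.
Proof.
move=> us.
have E t : (cmod (\sum_(n <- s) c n * cexponential n t) ^+ 2)%:E =
  (\sum_(n <- s) \sum_(m <- s)
    (Re (c n * conjc (c m) * cexponential (n - m) t))%:E)%E.
  rewrite sqr_cmodE rmorph_sum/= big_distrlr/= raddf_sum -sumEFin.
  apply: eq_bigr => n _; rewrite raddf_sum -sumEFin.
  apply: eq_bigr => m _; rewrite rmorphM/= -cexponentialM_conj.
  by congr (Re _)%:E; rewrite mulrACA.
under eq_integral do rewrite E.
have mI : measurable (`[0%R, 1%R]%classic : set (measurableTypeR R)) by [].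
(* The terms have no constant sign, so exchanging sum and integral rests on integrability, obtained
   from continuity on a compact interval. *)
have iF n m : lebesgue_measure.-integrable `[0%R, 1%R]
    (fun t : measurableTypeR R =>
      (Re (c n * conjc (c m) * cexponential (n - m) t))%:E).
  apply: continuous_compact_integrable; first exact: segment_compact.
  by apply: continuous_subspaceT => t; exact: continuous_Re_mulc_cexponential.
rewrite integral_sum//; last by move=> n; exact: integrable_sum.
under eq_bigr do rewrite integral_sum//.
rewrite -sumEFin big_seq [RHS]big_seq; apply: eq_bigr => n ns.
under eq_bigr do rewrite integral_Re_mulc_cexponential subr_eq0.
rewrite (bigD1_seq n)//= eqxx big1 ?adde0 -?sqr_cmodE// => m mn.
by rewrite eq_sym (negbTE mn).
Qed.

(** The indices of [symm_sum] as a list, the form in which [parseval_cexponential] takes them. *)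
Definition symm_seq (M : nat) : seq int :=
  [seq k%:Z - M%:Z | k <- iota 0 M.*2.+1].

Lemma symm_seq_uniq M : uniq (symm_seq M).
Proof. by rewrite map_inj_uniq ?iota_uniq// => i j /addIr []. Qed.

Lemma mem_symm_seq M (n : int) : (n \in symm_seq M) = (`|n| <= M)%N.
Proof.
apply/mapP/idP => [[k]|nM].
  rewrite mem_iota => /andP[_ kM] ->; lia.
exists `|(n + M%:Z)%R|%N; last by lia.
by rewrite mem_iota; lia.
Qed.

Lemma symm_sumE (R : realType) (F : int -> R[i]) M :
  symm_sum F M = \sum_(n <- symm_seq M) F n.
Proof. by rewrite big_map /symm_sum/index_iota subn0. Qed.

(** * Squared norms, and integrals with respect to a dominating measure *)

Lemma L2norm_sqr d (T : measurableType d) (R : realType)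
    (mu : {measure set T -> \bar R}) (f : T -> R[i]) :
  (L2norm mu f ^+ 2 = \int[mu]_x (cmod (f x) ^+ 2)%:E)%E.
Proof.
(* [Lnorm] is defined with real powers, which agree with the natural power 2 also at [+oo]; infinite
   norms are thus covered. *)
have sqE (x : \bar R) : (0 <= x -> x ^+ 2 = x `^ 2)%E.
  case: x => [r r0|_|//]; last by rewrite poweRyr.
  by rewrite poweR_EFin powR_mulrn// EFin_expe.
rewrite sqE ?Lnorm_ge0// poweR_Lnorm//.
apply: eq_integral => x _.
by rewrite poweR_EFin powR_mulrn// real_normK ?num_real.
Qed.

(** The restriction of [la] to [I], scaled by [m], is a measure below [mu], and integrals of
    nonnegative functions are monotone in the measure. The type of [m] is the one [mscale] takes. *)
Lemma ge0_integral_le_dominated d (T : measurableType d) (R : realType)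
    (mu la : {measure set T -> \bar R}) (m : {nonneg R})
    (I : set T) (h : T -> \bar R) :
  measurable I ->
  (forall A, measurable A -> m%:num%:E * la (A `&` I) <= mu A)%E ->
  measurable_fun [set: T] h -> (forall x, 0 <= h x)%E ->
  (m%:num%:E * \int[la]_(x in I) h x <= \int[mu]_x h x)%E.
Proof.
move=> mI lamu mh h0.
rewrite -(@eq_measure_integral _ _ _ I la (mrestr la mI)); last first.
  by move=> A mA AI; rewrite /= /mrestr setIidl.
rewrite -ge0_integral_mscale//; last exact: measurable_funTS.
apply: (@le_trans _ _ (\int[mu]_(x in I) h x)%E).
  by apply: ge0_le_measure_integral => // A mA; exact: lamu.
exact: ge0_subset_integral.
Qed.

(** Discarding the singular part and then the part of [A] outside [I] only decreases [mu A]; what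
    remains is the integral of [g] over a set where [g] is at least [m] almost everywhere. *)
Lemma ac_density_lower_bound d (T : measurableType d) (R : realType)
    (mu la : {measure set T -> \bar R}) (g : T -> \bar R) (m : R)
    (I A : set T) :
  measurable I -> 0 <= m -> is_ac_density mu la g ->
  {ae la, forall x, x \in I -> (m%:E <= g x)%E} ->
  measurable A -> (m%:E * la (A `&` I) <= mu A)%E.
Proof.
move=> mI m0 [mg g0 [s _ muE]] mg_le mA.
rewrite muE//; apply: (@le_trans _ _ (\int[la]_(x in A) g x)%E); last first.
  by rewrite leeDl.
apply: (@le_trans _ _ (\int[la]_(x in A `&` I) g x)%E); last first.
  apply: ge0_subset_integral => //; first exact: measurableI.
  exact: measurable_funTS.
have mAI : measurable (A `&` I) by exact: measurableI.
rewrite -integral_cst//; apply: ae_ge0_le_integral => //.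
- exact: measurable_funTS.
- by apply: filterS mg_le => x + [_ Ix]; apply; rewrite inE.
Qed.

Lemma sqr_cmod_le (R : rcfType) (u v : R[i]) :
  cmod u ^+ 2 <= 2 * cmod v ^+ 2 + 2 * cmod (v - u) ^+ 2.
Proof.
rewrite !sqr_cmod; case: u v => a b [c d] /=.
(* This is [|2 v - u|^2], the exact difference of the two sides. *)
have : 0 <= (2 * c - a) ^+ 2 + (2 * d - b) ^+ 2 by rewrite addr_ge0 ?sqr_ge0.
nra.
Qed.

(** * Measurability of trigonometric polynomials *)

Lemma measurable_sqr_cmod d (T : measurableType d) (R : realType)
    (f : T -> R[i]) :
  measurable_fun [set: T] (fun x => Re (f x)) ->
  measurable_fun [set: T] (fun x => Im (f x)) ->
  measurable_fun [set: T] (fun x => (cmod (f x) ^+ 2)%:E).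
Proof.
move=> mr mi; apply/measurable_EFinP.
under eq_fun do rewrite sqr_cmod.
by apply: measurable_funD; apply: measurable_funX.
Qed.

Lemma measurable_Re_trig_sum (R : realType) (s : seq int) (c : int -> R[i]) :
  measurable_fun [set: measurableTypeR R]
    (fun t => Re (\sum_(n <- s) c n * cexponential n t)).
Proof.
under eq_fun do rewrite raddf_sum.
apply: measurable_sum => n; apply: continuous_measurable_fun.
exact: continuous_Re_mulc_cexponential.
Qed.

Lemma measurable_Im_trig_sum (R : realType) (s : seq int) (c : int -> R[i]) :
  measurable_fun [set: measurableTypeR R]
    (fun t => Im (\sum_(n <- s) c n * cexponential n t)).
Proof.
(* Since [Im w = Re (- i w)], the real case applies to the coefficients [- i c_n]. *)
have -> : (fun t => Im (\sum_(n <- s) c n * cexponential n t)) =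
    (fun t => Re (\sum_(n <- s) (- 'i * c n) * cexponential n t)).
  apply/funext => t; under [in RHS]eq_bigr do rewrite -mulrA.
  rewrite -mulr_sumr; case: (\sum_(n <- s) _) => a b /=; ring.
exact: measurable_Re_trig_sum.
Qed.

(** * Bounds on the coefficients of an indicator *)

(** The estimate at a fixed [M], with the expansion error kept. Parseval makes the left side a
    Lebesgue integral, and only the error term is passed to [mu]. Keeping the factor [m] avoids a
    division in the extended reals. *)
Lemma sum_sqr_coef_le (R : realType)
    (mu : {measure set (measurableTypeR R) -> \bar R}) (m : R)
    (E : set (measurableTypeR R)) (c : int -> R[i]) (M : nat) :
  0 < m ->
  (forall B : set (measurableTypeR R), measurable B ->
    (m%:E * lebesgue_measure (B `&` `[0%R, 1%R[) <= mu B)%E) ->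
  measurable E -> E `<=` `[0%R, 1%R[ ->
  (m%:E * (\sum_(n <- symm_seq M) cmod (c n) ^+ 2)%:E <=
    m%:E * (2%:E * lebesgue_measure E) + 2%:E * L2norm mu (fun t =>
       (\1_E t)%:C - symm_sum (fun n => c n * cexponential n t) M)%R ^+ 2)%E.
Proof.
move=> m0 mu_ge mE EI.
set leb := @lebesgue_measure R.
pose I01 : set (measurableTypeR R) := `[0%R, 1%R[%classic.
pose S t := \sum_(n <- symm_seq M) c n * cexponential n t.
have -> : (fun t => (\1_E t)%:C -
    symm_sum (fun n => c n * cexponential n t) M) =
  (fun t => (\1_E t)%:C - S t).
  by apply/funext => t; rewrite symm_sumE.
have mReS : measurable_fun [set: measurableTypeR R] (fun t => Re (S t)).
  exact: measurable_Re_trig_sum.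
have mImS : measurable_fun [set: measurableTypeR R] (fun t => Im (S t)).
  exact: measurable_Im_trig_sum.
have mS : measurable_fun [set: measurableTypeR R]
    (fun t => (cmod (S t) ^+ 2)%:E).
  exact: measurable_sqr_cmod.
have mD : measurable_fun [set: measurableTypeR R]
    (fun t => (cmod ((\1_E t)%:C - S t) ^+ 2)%:E).
  apply: measurable_sqr_cmod.
    have -> : (fun x => Re ((\1_E x)%:C - S x)) = (fun x => \1_E x - Re (S x)).
      by apply/funext => x; case: (S x).
    by apply: measurable_funB.
  have -> : (fun x => Im ((\1_E x)%:C - S x)) = (fun x => - Im (S x)).
    by apply/funext => x; case: (S x) => a b /=; rewrite sub0r.
  exact: measurableT_comp.
have mI : measurable I01 by exact: measurable_itv.
rewrite L2norm_sqr -parseval_cexponential ?symm_seq_uniq//.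
(* Parseval is stated on the closed interval, domination on the half-open one; the endpoint 1 is
   Lebesgue-null. *)
rewrite -integral_itv_bndo_bndc; last exact: measurable_funTS.
have ->: leb E = (\int[leb]_(t in I01) (\1_E t)%:E)%E.
  by rewrite integral_indic// setIidl.
(* The pointwise bound is first integrated over [I01]; the error integral is then compared with its
   counterpart for [mu]. *)
apply: (@le_trans _ _ (m%:E * (2%:E * \int[leb]_(t in I01) (\1_E t)%:E +
    2%:E * \int[leb]_(t in I01) (cmod ((\1_E t)%:C - S t) ^+ 2)%:E))%E).
  apply: lee_wpmul2l; first by rewrite lee_fin ltW.
  rewrite -!ge0_integralZl//; last 3 first.
  - exact: measurable_funTS.
  - by move=> t _; rewrite lee_fin sqr_ge0.
  - by apply: measurable_funTS; exact/measurable_EFinP.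
  rewrite -ge0_integralD//; last 3 first.
  - by apply: measurable_funTS; apply: measurable_funeM; exact/measurable_EFinP.
  - by move=> t _; rewrite mule_ge0// lee_fin sqr_ge0.
  - by apply: measurable_funTS; exact: measurable_funeM.
  apply: ge0_le_integral => //.
  - by move=> t _; rewrite lee_fin sqr_ge0.
  - exact: measurable_funTS.
  - by apply: measurable_funTS; apply: emeasurable_funD;
      apply: measurable_funeM => //; exact/measurable_EFinP.
  - move=> t _; rewrite -!EFinM -EFinD lee_fin.
    apply: (le_trans (sqr_cmod_le _ _ (\1_E t)%:C)); rewrite lerD2r ler_pM2l//.
    rewrite sqr_cmod /= expr0n addr0 /= indicE.
    by case: (_ \in _); rewrite ?expr1n ?expr0n.
rewrite ge0_muleDr; last 2 first.
- by apply: mule_ge0 => //; apply: integral_ge0 => t _; rewrite lee_fin.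
- by apply: mule_ge0 => //; apply: integral_ge0 => t _; rewrite lee_fin sqr_ge0.
apply: leeD2l; rewrite muleCA; apply: lee_wpmul2l => //.
pose m' : {nonneg R} := NngNum (ltW m0).
apply: (@ge0_integral_le_dominated _ _ _ mu leb m' I01) => //.
by move=> t; rewrite lee_fin sqr_ge0.
Qed.

(** The unordered sum is a supremum over finite index sets, and each of these lies in a symmetric
    window, which can be enlarged until the expansion error is negligible. Convergence of symmetric
    partial sums therefore suffices. *)
Lemma esum_sqr_coef_le (R : realType)
    (mu : {measure set (measurableTypeR R) -> \bar R}) (m : R)
    (E : set (measurableTypeR R)) (c : int -> R[i]) :
  0 < m ->
  (forall B : set (measurableTypeR R), measurable B ->
    (m%:E * lebesgue_measure (B `&` `[0%R, 1%R[) <= mu B)%E) ->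
  measurable E -> E `<=` `[0%R, 1%R[ ->
  (fun M : nat => L2norm mu (fun t =>
       (\1_E t)%:C - symm_sum (fun n => c n * cexponential n t) M))
    @ \oo --> 0%E ->
  (\esum_(n in [set: int]) (cmod (c n) ^+ 2)%:E <= 2%:E * lebesgue_measure E)%E.
Proof.
move=> m0 mu_ge mE EI; set h := (fun M : nat => _) => h0.
have hge0 M : (0 <= h M)%E by exact: Lnorm_ge0.
apply: ge_ereal_sup => _ [X [finX _] <-].
apply/lee_addgt0Pr => e e0.
(* Chosen so that [2 r^2 = m e]: the error term of [sum_sqr_coef_le] then costs at most [e] once [m]
   is cancelled. *)
pose r := Num.sqrt (m * e / 2).
have r0 : 0 < r by rewrite sqrtr_gt0 divr_gt0// mulr_gt0.
have [N _ hN] : \forall M \near \oo, (h M < r%:E)%E.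
  apply: (h0 [set x | (x < r%:E)%E]).
  by apply: open_ereal_lt'; rewrite lte_fin.
have [K XK] : exists K, forall n, X n -> (`|n| <= K)%N.
  have [s Xs] := (finite_seqP X).1 finX.
  exists (\max_(k <- s) `|k|%N)%N => n; rewrite Xs => /= ns.
  exact: leq_bigmax_seq.
(* [N] makes the error small and [K] makes the window contain [X]. *)
pose M := maxn N K.
have hM : (h M ^+ 2 <= (m * e / 2)%:E)%E.
  have := hN M (leq_maxl _ _); have := hge0 M; rewrite /=.
  case: (h M) => [y| |]//; rewrite lee_fin lte_fin => y0 yr.
  rewrite -EFinM -expr2 lee_fin -[leRHS]sqr_sqrtr; last first.
    by rewrite ltW// divr_gt0// mulr_gt0.
  by rewrite lerXn2r ?nnegrE// ltW.
apply: (@le_trans _ _ (\sum_(n <- symm_seq M) cmod (c n) ^+ 2)%:E).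
  rewrite -sumEFin [leRHS]fsbig_seq ?symm_seq_uniq//.
  apply: lee_fsum_nneg_subset => //.
    move=> n; rewrite !inE /= mem_symm_seq => /XK nK.
    by rewrite (leq_trans nK)// leq_maxr.
  by move=> n _; rewrite lee_fin sqr_ge0.
have := sum_sqr_coef_le _ mu _ E c M m0 mu_ge mE EI; rewrite -/(h M) => H.
rewrite -(@lee_pmul2l _ m%:E)//; apply: (le_trans H).
rewrite ge0_muleDr ?mule_ge0//; last by rewrite lee_fin ltW.
apply: leeD2l; apply: (@le_trans _ _ (2%:E * (m * e / 2)%:E)%E).
  exact: lee_wpmul2l.
by rewrite -!EFinM lee_fin mulrC divfK.
Qed.

(** * Indicators as test functions in the frame inequality *)

Lemma inL2_indic d (T : measurableType d) (R : realType)
    (mu : {finite_measure set T -> \bar R}) (E : set T) : measurable E ->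
  inL2 mu (fun x => (\1_E x)%:C) /\
  (L2norm mu (fun x => (\1_E x)%:C) ^+ 2 = mu E)%E.
Proof.
move=> mE.
have N2 : (L2norm mu (fun x => (\1_E x)%:C) ^+ 2 = mu E)%E.
  rewrite L2norm_sqr -(setIT E) -integral_indic//.
  apply: eq_integral => x _; rewrite sqr_cmod /= expr0n addr0 /= setIT indicE.
  by case: (_ \in _); rewrite ?expr1n ?expr0n.
split=> //; split; [exact: measurable_indic|exact: measurable_cst|].
(* An infinite norm would have an infinite square, contradicting the finiteness of [mu E]. *)
rewrite ltey; apply/eqP => Noo.
have : (mu E < +oo)%E by rewrite ltey_eq fin_num_measure.
by rewrite -N2 Noo.
Qed.

(** The frame inequality is tested on the indicator of [E], whose squared norm is [mu E]. Both
    conclusions of the theorem are drawn from this comparison of measures. *)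
Lemma semi_lower_frame_measure_le (R : realType)
    (mu : {finite_measure set (measurableTypeR R) -> \bar R}) (m : R)
    (gn : int -> measurableTypeR R -> R[i])
    (E : set (measurableTypeR R)) (A : R) :
  0 < m ->
  (forall B : set (measurableTypeR R), measurable B ->
    (m%:E * lebesgue_measure (B `&` `[0%R, 1%R[) <= mu B)%E) ->
  (forall f, inL2 mu f -> (A%:E * L2norm mu f ^+ 2 <=
       \esum_(n in [set: int]) (cmod (L2inner mu f (gn n)) ^+ 2)%:E)%E) ->
  dextrodual mu gn (@cexponential R) ->
  measurable E -> E `<=` `[0%R, 1%R[ ->
  (A%:E * mu E <= 2%:E * lebesgue_measure E)%E.
Proof.
move=> m0 mum frame dual mE EI.
have [fL2 <-] := inL2_indic _ _ _ mu E mE.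
apply: (le_trans (frame _ fL2)).
by apply: (esum_sqr_coef_le _ mu _ E _ m0 mum mE EI); exact: dual.
Qed.

Theorem theorem3p3 (R : realType)
    (mu : {finite_measure set (measurableTypeR R) -> \bar R})
    (mu_supp : mu (~` `[0, 1[%classic) = 0%E)
    (g : measurableTypeR R -> \bar R)
    (g_density : is_ac_density mu (@lebesgue_measure R) g)
    (g_bounded_below : exists2 m : R, 0 < m &
      {ae @lebesgue_measure R, forall x, x \in `[0, 1[ -> (m%:E <= g x)%E})
    (gn : int -> measurableTypeR R -> R[i])
    (gn_L2 : forall n, inL2 mu (gn n))
    (gn_frame : semi_lower_frame mu gn)
    (gn_dual : dextrodual mu gn (@cexponential R)) :
  (exists M : R,
     {ae @lebesgue_measure R, forall x, x \in `[0, 1[ -> (g x <= M%:E)%E}) /\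
  mu `<< @lebesgue_measure R.
Proof.
have [m m0 gm] := g_bounded_below; have [A A0 frame] := gn_frame.
set leb := @lebesgue_measure R.
pose I : set (measurableTypeR R) := `[0%R, 1%R[%classic.
have mI : measurable I by exact: measurable_itv.
have mum B : measurable B -> (m%:E * leb (B `&` I) <= mu B)%E.
  apply: (@ac_density_lower_bound _ _ _ mu leb g) => //; first exact: ltW.
  apply: filterS (gm); first exact: (ae_filter_ringOfSetsType leb).
  by move=> x + xI; apply; exact: (set_mem xI).
have mu_le E : measurable E -> E `<=` I -> (A%:E * mu E <= 2%:E * leb E)%E.
  by move=> mE EI; exact: (semi_lower_frame_measure_le _ _ m gn).
split; last first.
  (* A null set [Z] is covered by its trace on [I], where [mu_le] applies, and the complement of
     [I], which [mu_supp] makes [mu]-null. *)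
  apply/null_content_dominatesP => Z mZ Z0.
  have mZI : measurable (Z `&` I) by exact: measurableI.
  have ZI0 : mu (Z `&` I) = 0%E.
    have := mu_le _ mZI (@subIsetr _ _ _).
    have -> : leb (Z `&` I) = 0%E.
      exact: (subset_measure0 mZI mZ (@subIsetl _ _ _) Z0).
    rewrite mule0 => h.
    apply/eqP; rewrite eq_le measure_ge0 andbT.
    by rewrite -(@lee_pmul2l _ A%:E)// mule0.
  apply: (subset_measure0 mZ (measurableU _ _ mZI (measurableC mI))).
    by move=> x Zx; have [Ix|nIx] := pselect (I x); [left|right].
  apply/eqP; rewrite eq_le measure_ge0 andbT.
  have : (mu ((Z `&` I) `|` ~` I) <= mu (Z `&` I) + mu (~` I))%E.
    exact: measureU2 mZI (measurableC mI).
  by rewrite ZI0 [X in (_ + X)%E]mu_supp adde0.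
(* Any constant above [2 / A] would do. Where [g] is at least [3 / A], the comparison gives
   [3 |E| <= A mu(E) <= 2 |E|], so this set is null. *)
exists (3 / A).
have [mg g0 [s _ muE]] := g_density.
pose E := I `&` [set x | ((3 / A)%:E <= g x)%E].
have mE : measurable E.
  by apply: emeasurable_fun_c_infty => //; exact: measurable_funTS.
have E0 : leb E = 0%E.
  (* Finiteness matters: [3 x <= 2 x] also holds at [x = +oo]. *)
  have Efin : leb E \is a fin_num.
    rewrite ge0_fin_numE//; apply: (@le_lt_trans _ _ (leb I)).
      by apply: le_measure; rewrite ?inE//; exact: subIsetl.
    by rewrite /leb /I lebesgue_measure_itv/= lte01 oppr0 adde0 ltry.
  have h1 : ((3 / A)%:E * leb E <= mu E)%E.
    rewrite muE// -integral_cst//.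
    apply: (@le_trans _ _ (\int[leb]_(x in E) g x)%E); last by rewrite leeDl.
    apply: ge0_le_integral => //.
    - by move=> x _; rewrite lee_fin divr_ge0// ltW.
    - exact: measurable_funTS.
    - by move=> x [].
  have h2 : (3%:E * leb E <= 2%:E * leb E)%E.
    apply: le_trans (mu_le _ mE (@subIsetl _ _ _)).
    rewrite -[3%R](@divfK _ A) ?gt_eqF// mulrC EFinM -muleA.
    by apply: lee_wpmul2l => //; rewrite lee_fin ltW.
  have h3 : (0 <= leb E)%E by exact: measure_ge0.
  move: Efin h2 h3; case: (leb E) => [r _| |]//.
  by rewrite -!EFinM !lee_fin => h2 h3; congr EFin; lra.
exists E; split => // x /= /not_implyP [Ix gx]; split; first exact: Ix.
by rewrite /= ltW// ltNge; apply/negP.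
Qed.
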